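(* Let $r\ge1$. For each $l=1,\ldots,r$ let $\nu^{0l}$ be a common eigenvector of the matrices $A_j$ corresponding to the eigenvalues $\lambda_l^j$, $j=1,\ldots,m$, and let $\nu^{\theta l}$, $\theta=1,\ldots,s_l-1$, be generalized eigenvectors of order $\theta$ of $A_\zeta$ corresponding to the eigenvalue $\lambda_l^\zeta$ with elementary divisor of multiplicity $s_l\ge2$. Assume $\sum_{l=1}^rs_l\ge m+1$. Let $v_{\theta l}^\zeta\colon\mathscr X\to\mathbb R$, $\theta=1,\ldots,s_l-1$, be the solution of the system $$\nu^{\theta l}x=\sum_{\delta=1}^\theta\binom{\theta-1}{\delta-1}v_{\delta l}^\zeta(x)\,\nu^{\theta-\delta,l}x,\quad\theta=1,\ldots,s_l-1,$$ on a domain $\mathscr X$ on which $\nu^{0l}x\neq0$, $l=1,\ldots,r$. Assume that none of the functions $x\to\mathfrak p_jv_{\theta l}^\zeta(x)$, $j=1,\ldots,m$, $j\ne\zeta$, $\theta=1,\ldots,s_l-1$, $l=1,\ldots,r$, is a (nonconstant) first integral of the ordinary differential system $dx=A^\zeta(x)\,dt_\zeta$. Let $\mu_{\theta l}^{j\zeta}=\mathfrak p_jv_{\theta l}^\zeta(x)$, $j=1,\ldots,m$ (constants). Then the completely solvable system $dx=A(x)\,dt$ has the autonomous first integral $$F\colon x\to\prod_{\xi=1}^{k}\bigl(\nu^{0\xi}x\bigr)^{h_{0\xi}}\exp\sum_{q=1}^{\varepsilon_\xi}h_{q\xi}v_{q\xi}^\zeta(x)\quad\text{for all }x\in\mathscr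 X,\quad\mathscr X\subset{\rm D}(F),$$ where $\sum_{\xi=1}^k\varepsilon_\xi=m-k+1$, $\varepsilon_\xi\le s_\xi-1$, $\xi=1,\ldots,k$, $k\le r$, and $h_{q\xi}$, $q=0,\ldots,\varepsilon_\xi$, $\xi=1,\ldots,k$, is a nontrivial solution of the linear homogeneous system $$\sum_{\xi=1}^k\Bigl(\lambda_\xi^jh_{0\xi}+\sum_{q=1}^{\varepsilon_\xi}\mu_{q\xi}^{j\zeta}h_{q\xi}\Bigr)=0,\quad j=1,\ldots,m.$$
   Context: Let $x=(x_1,\ldots,x_n)\in\mathbb R^n$, $t=(t_1,\ldots,t_m)\in\mathbb R^m$. Consider the linear autonomous system of equations in total differentials $dx=A(x)\,dt$, where $A(x)=\|a_{ij}(x)\|$ is $n\times m$ with $a_{ij}(x)=\sum_{\xi=1}^na_{ij\xi}x_\xi$, $a_{ij\xi}\in\mathbb R$. Put $\mathfrak p_j(x)=\sum_{i=1}^na_{ij}(x)\partial_{x_i}$, $j=1,\ldots,m$. The system is assumed completely solvable: $[\mathfrak p_j,\mathfrak p_\zeta]=0$ on $\mathbb R^n$ for all $j,\zeta$. Let $A_j$ be the real $n\times n$ matrix whose entry in row $i$ and column $\xi$ is $a_{\xi ji}$ (so the system is $dx=\sum_jA_j^{T}x\,dt_j$); complete solvability is equivalent to $A_jA_\zeta=A_\zeta A_j$ for all $j,\zeta$. For a vector $\nu$, $\nu x=\sum_{i=1}^n\nu_ix_i$. The index $\zeta\in\{1,\ldots,m\}$ is fixed so that $A_\zeta$ has the smallest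 number of elementary divisors, and $A^\zeta(x)$ is the column $(a_{1\zeta}(x),\ldots,a_{n\zeta}(x))$; a first integral of $dx=A^\zeta(x)dt_\zeta$ here means a nonconstant function annihilated by $\mathfrak p_\zeta$. If $\nu^{0l}$ is an eigenvector of $A_\zeta$ for the eigenvalue $\lambda_l^\zeta$ with elementary divisor of multiplicity $s_l$, a nonzero vector $\nu^{\theta l}\in\mathbb C^n$ is a generalized eigenvector of order $\theta$ if $(A_\zeta-\lambda_l^\zeta E)\nu^{\theta l}=\theta\,\nu^{\theta-1,l}$, $\theta=1,\ldots,s_l-1$ ($E$ the identity matrix). A continuously differentiable function $F$ on a domain $\mathscr X\subset\mathbb R^n$ is an autonomous first integral of $dx=A(x)dt$ if $\mathfrak p_jF=0$ on $\mathscr X$, $j=1,\ldots,m$. ${\rm D}(F)$ is the set where $F$ is defined and continuously differentiable. The $\varepsilon_\xi$ are nonnegative integers; empty sums are zero. *)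

(* Defs.v *)
From HB Require Import structures.
From mathcomp Require Import all_boot all_order all_algebra.
From mathcomp Require Import all_classical all_reals all_analysis.
From mathcomp.real_closed Require Import complex.

Set Implicit Arguments.
Unset Strict Implicit.
Unset Printing Implicit Defensive.

Import Order.TTheory GRing.Theory Num.Theory.
Import numFieldNormedType.Exports.

Local Open Scope ring_scope.
Local Open Scope classical_set_scope.
Local Open Scope complex_scope.

Section ComplexPower.
Variable R : realType.
Implicit Types z w : R[i].

Definition cmod z : R := Num.sqrt (complex.Re z ^+ 2 + complex.Im z ^+ 2).

(* Principal argument, with values in ]-pi, pi] for z != 0. *)
Definition carg z : R :=
  if 0 <= complex.Im z then acos (complex.Re z / cmod z)
  else - acos (complex.Re z / cmod z).

Definition cexp z : R[i] :=
  (expR (complex.Re z) * cos (complex.Im z))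
    +i* (expR (complex.Re z) * sin (complex.Im z)).

Definition clog z : R[i] := ln (cmod z) +i* carg z.

(* Principal value of the power; it is only used at z != 0. *)
Definition cpow z w : R[i] := cexp (w * clog z).

End ComplexPower.

(* Elementary divisors in the classical way: the k-th determinantal divisor is
   the gcd of the minors of order k of 'X - A, the k-th invariant factor is the
   quotient of two consecutive determinantal divisors, and the elementary
   divisors ('X - z)^s, recorded as pairs (z, s) and listed with repetition, are
   the maximal powers of linear factors in the invariant factors.  All these
   polynomials are taken up to a nonzero constant.  The row and column selections
   f and g need not be increasing or injective: this only adds minors that are
   zero, or equal up to sign to the usual ones. *)
Section ElementaryDivisors.
Variables (C : closedFieldType) (n : nat).
Implicit Type A : 'M[C]_n.

Definition determinantal_divisor A (k : nat) : {poly C} :=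
  \big[@gcdp C/0]_(f : {ffun 'I_k -> 'I_n})
    \big[@gcdp C/0]_(g : {ffun 'I_k -> 'I_n})
      \det (mxsub f g (char_poly_mx A)).

Definition invariant_factor A (k : nat) : {poly C} :=
  determinantal_divisor A k %/ determinantal_divisor A k.-1.

Definition roots_with_mult (p : {poly C}) : seq C :=
  sval (closed_field_poly_normal p).

Definition elementary_divisors A : seq (C * nat) :=
  flatten [seq tally (roots_with_mult (invariant_factor A k)) | k <- iota 1 n].

End ElementaryDivisors.

Section System.
Variables (R : realType) (n m : nat).

(* a i j xi is the coefficient of x_xi in the entry (i, j) of A(x). *)
Variable a : 'I_n -> 'I_m -> 'I_n -> R.

Definition coef_A (i : 'I_n) (j : 'I_m) (x : 'cV[R]_n) : R :=
  \sum_(xi < n) a i j xi * x xi 0.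

Definition partial (i : 'I_n) (f : 'cV[R]_n -> R) (x : 'cV[R]_n) : R :=
  'D_(delta_mx i 0) f x.

Definition frakp (j : 'I_m) (f : 'cV[R]_n -> R) (x : 'cV[R]_n) : R :=
  \sum_(i < n) coef_A i j x * partial i f x.

(* The i-th component of the vector field [p_j, p_l]. *)
Definition lie_bracket (j l : 'I_m) (i : 'I_n) (x : 'cV[R]_n) : R :=
  frakp j (coef_A i l) x - frakp l (coef_A i j) x.

Definition completely_solvable : Prop :=
  forall j l i x, lie_bracket j l i x = 0.

(* The matrix A_j, seen as a complex matrix: note the transposition. *)
Definition mxA (j : 'I_m) : 'M[R[i]]_n :=
  \matrix_(i < n, xi < n) (a xi j i)%:C.

Definition is_domain (X : set 'cV[R]_n) : Prop :=
  [/\ open X, connected X & X !=set0].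

Definition C1_on (X : set 'cV[R]_n) (f : 'cV[R]_n -> R) : Prop :=
  forall x, X x ->
    differentiable f x /\ forall i, {for x, continuous (partial i f)}.

Definition ode_first_integral (zeta : 'I_m) (X : set 'cV[R]_n)
    (g : 'cV[R]_n -> R) : Prop :=
  [/\ C1_on X g,
      forall x, X x -> frakp zeta g x = 0
    & exists x y, [/\ X x, X y & g x <> g y]].

(* Complex-valued functions are differentiated through their real and imaginary
   parts, so for real-valued F this is the usual notion.  C1_on X is the
   inclusion of X in D(F). *)
Definition autonomous_first_integral (X : set 'cV[R]_n)
    (F : 'cV[R]_n -> R[i]) : Prop :=
  let F1 := fun x => complex.Re (F x) in
  let F2 := fun x => complex.Im (F x) in
  [/\ C1_on X F1, C1_on X F2
    & forall j x, X x -> frakp j F1 x = 0 /\ frakp j F2 x = 0].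

(* The linear form written "nu x". *)
Definition lform (nu : 'cV[R[i]]_n) (x : 'cV[R]_n) : R[i] :=
  \sum_(i < n) nu i 0 * (x i 0)%:C.

Definition is_common_eigenvector (nu : 'cV[R[i]]_n) (lam : 'I_m -> R[i]) : Prop :=
  nu != 0 /\ forall j, mxA j *m nu = lam j *: nu.

Definition is_generalized_eigenvector (A : 'M[R[i]]_n) (lam : R[i])
    (nu : nat -> 'cV[R[i]]_n) (theta : nat) : Prop :=
  nu theta != 0 /\ (A - lam%:M) *m nu theta = theta%:R *: nu theta.-1.

Section Family.
Variable r : nat.
(* l : 'I_r stands for the index l + 1 of the 1-based enumeration. *)
Variables (nu : 'I_r -> nat -> 'cV[R[i]]_n) (lam : 'I_r -> 'I_m -> R[i]).
Variables (s : 'I_r -> nat) (v : 'I_r -> nat -> 'cV[R]_n -> R).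
Variable mu : 'I_r -> nat -> 'I_m -> R.

Definition solves_v_system (X : set 'cV[R]_n) : Prop :=
  forall l theta, (0 < theta < s l)%N -> forall x, X x ->
    lform (nu l theta) x =
      \sum_(1 <= delta < theta.+1)
        'C(theta.-1, delta.-1)%:R * (v l delta x)%:C
          * lform (nu l (theta - delta)%N) x.

(* The equation on eps is sum eps = m - k + 1 without truncated subtraction. *)
Definition admissible_orders (k : nat) (eps : 'I_r -> nat) : Prop :=
  [/\ (k <= r)%N,
      (\sum_(xi < r | (xi < k)%N) eps xi + k = m.+1)%N
    & forall xi : 'I_r, (xi < k)%N -> (eps xi <= s xi - 1)%N].

Definition nontrivial_solution (k : nat) (eps : 'I_r -> nat)
    (h : 'I_r -> nat -> R[i]) : Prop :=
  (exists (xi : 'I_r) (q : nat),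
     [/\ (xi < k)%N, (q <= eps xi)%N & h xi q != 0]) /\
  forall j : 'I_m,
    \sum_(xi < r | (xi < k)%N)
      (lam xi j * h xi 0%N
         + \sum_(1 <= q < (eps xi).+1) (mu xi q j)%:C * h xi q) = 0.

Definition integral_F (k : nat) (eps : 'I_r -> nat)
    (h : 'I_r -> nat -> R[i]) (x : 'cV[R]_n) : R[i] :=
  \prod_(xi < r | (xi < k)%N)
    (cpow (lform (nu xi 0%N) x) (h xi 0%N)
       * cexp (\sum_(1 <= q < (eps xi).+1) h xi q * (v xi q x)%:C)).

End Family.
End System.

(* Main.v *)
Require Import Defs.
From HB Require Import structures.
From mathcomp Require Import all_boot all_order all_algebra.
From mathcomp Require Import all_classical all_reals all_analysis.
From mathcomp.real_closed Require Import complex.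
From mathcomp Require Import ring lra zify.

(** The operators [frakp a j] are derivations that act on linear forms through the
matrices of the system ([frakp_rform]).  So the logarithm of the form of a common
eigenvector is mapped to the eigenvalue, and if each [v l theta] is also mapped to
a constant [mu l theta j], then a combination of these logarithms and of the
functions [v l theta] is annihilated by every operator exactly when its
coefficients solve a homogeneous linear system of [m] equations.  The function in
the theorem is the exponential of such a combination
([frakp_log_combination], [exp_first_integral]).

The derivatives of [v l theta] are constant for the following reason.  For the
index [zeta], differentiating the triangular system that defines the [v l theta]
shows that [v l 1] has derivative 1 and that the others have derivative 0
([frakp_quotient]).  For another index [j], complete solvability makes the two
derivations commute ([frakp_commute]), so [frakp a j (v l theta)] is annihilated by
[frakp a zeta]; since it is not a nonconstant first integral of that field, it is
constant.

The vectors are complex whereas the functions [v l theta] are real, and powers of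
complex linear forms are taken with the principal logarithm, which jumps across the
negative half-line.  That no jump is met is a consequence of the hypotheses: if two
linear forms that are not proportional have a real quotient on an open set, both are
real up to a common complex factor.  Each chain is therefore a fixed complex
multiple of a chain of real vectors whose first form is positive on the connected
domain ([common_phase]), the eigenvalues are real ([real_eigenvalue]), and along
the domain the first form stays on one half-line, where the principal argument is
constant ([clog_ray]).

Nontrivial exponents exist, even real ones: the blocks contain at least [m + 1]
vectors, so orders can be chosen that give [m + 1] unknowns
([exists_admissible_orders]), and a homogeneous system of [m] real equations in
[m + 1] unknowns has a nonzero solution. *)

Set Implicit Arguments.
Unset Strict Implicit.
Unset Printing Implicit Defensive.

Import Order.TTheory GRing.Theory Num.Theory.
Import numFieldNormedType.Exports.

Local Open Scope ring_scope.
Local Open Scope classical_set_scope.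
Local Open Scope complex_scope.

(** * Partial derivatives and smooth functions *)

(** The difference of the two functions vanishes near the point, so it is a
little-o of the increment and has differential zero. *)
Lemma near_eq_differentiable (K : numFieldType) (V W : normedModType K)
    (f g : V -> W) (x : V) :
  (\near x, f x = g x) -> differentiable f x -> differentiable g x.
Proof.
move=> fg df; pose h y := g y - f y.
have h0 : \forall y \near x, h y = 0.
  by apply: filterS fg => y /= E; rewrite /h E subrr.
have -> : g = f + h by apply/funext => y; rewrite /h fctE addrC subrK.
apply: differentiableD => //.
have hx0 : h x = 0 by exact: nbhs_singleton h0.
have hE : h \o shift x = cst (h x) + (\0 : {linear V -> W}) +o_ 0 id.
  have := h0; rewrite (near_shift 0) => h0'.
  apply/eqaddoP => e e0; near=> y => /=.
  rewrite !fctE /= hx0 addr0 subr0.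
  suff -> : h (y + x) = 0 by rewrite normr0 mulr_ge0// ltW.
  near: y; apply: filterS h0' => y /=; rewrite subr0 => <- //.
apply/diff_locallyP; rewrite (diff_unique _ hE); last exact: cst_continuous.
by split => //; exact: cst_continuous.
Unshelve. all: by end_near. Qed.

Section PartialDerivatives.
Variables (R : realType) (n : nat).
Implicit Types (f g : 'cV[R]_n -> R) (x : 'cV[R]_n) (phi : R -> R).

Lemma partial_coord i j x : partial i (fun y => y j 0) x = (j == i)%:R.
Proof.
have lin : linear (fun y : 'cV[R]_n => y j 0 : R) by move=> c y z; rewrite !mxE.
pose L := GRing.isLinear.Build _ _ _ _ _ lin.
pose f : {linear 'cV[R]_n -> R} := HB.pack (fun y : 'cV[R]_n => y j 0 : R) L.
have fc : continuous f by move=> y; exact: coord_continuous.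
rewrite /partial deriveE; last exact: differentiable_coord.
by rewrite (diff_lin x fc) /= mxE eqxx andbT.
Qed.

Lemma partial_cst i c x : partial i (fun=> c) x = 0.
Proof. exact: derive_cst. Qed.

Lemma partialD i f g x : differentiable f x -> differentiable g x ->
  partial i (fun y => f y + g y) x = partial i f x + partial i g x.
Proof. by move=> df dg; rewrite /partial deriveD//; exact: diff_derivable. Qed.

Lemma partialM i f g x : differentiable f x -> differentiable g x ->
  partial i (fun y => f y * g y) x = f x * partial i g x + g x * partial i f x.
Proof. by move=> df dg; rewrite /partial deriveM//; exact: diff_derivable. Qed.

Lemma differentiable_chain phi d f x : differentiable f x ->
  is_derive (f x) 1 phi d -> differentiable (fun y => phi (f y)) x.
Proof.
move=> df [phi_drv _]; apply: (differentiable_comp df).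
exact/derivable1_diffP.
Qed.

Lemma partial_chain i phi d f x : differentiable f x ->
  is_derive (f x) 1 phi d ->
  partial i (fun y => phi (f y)) x = d * partial i f x.
Proof.
move=> df phi_drv; have dphi : differentiable phi (f x).
  by apply/derivable1_diffP; case: phi_drv.
rewrite /partial deriveE; last exact: differentiable_chain phi_drv.
rewrite (diff_comp df dphi) /= (deriveE _ df).
set t := 'd f x _; rewrite -[in LHS](mulr1 t).
rewrite -[t * 1]/(t *: (1 : R^o)) linearZ /= -deriveE//.
by case: phi_drv => _ ->; rewrite mulrC.
Qed.

Lemma eq_on_near (X : set 'cV[R]_n) f g x : open X -> X x ->
  (forall y, X y -> f y = g y) -> {near x, f =1 g}.
Proof.
move=> Xo Xx fg; near=> y; apply: fg; near: y; exact: open_nbhs_nbhs.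
Unshelve. all: by end_near. Qed.

Lemma eq_on_partial (X : set 'cV[R]_n) i f g x : open X -> X x ->
  (forall y, X y -> f y = g y) -> partial i f x = partial i g x.
Proof. by move=> Xo Xx fg; apply: near_eq_derive; exact: eq_on_near fg. Qed.

Lemma eq_on_differentiable (X : set 'cV[R]_n) f g x : open X -> X x ->
  (forall y, X y -> f y = g y) -> differentiable f x -> differentiable g x.
Proof. by move=> Xo Xx fg; apply: near_eq_differentiable; exact: eq_on_near fg. Qed.
End PartialDerivatives.

Section SmoothFunctions.
Variables (R : realType) (n : nat) (X : set 'cV[R]_n).
Hypothesis X_open : open X.

(** A class of functions generated by operations, rather than the class of all
infinitely differentiable functions: it contains everything that occurs below,
it is stable under partial derivatives, and the commutation of two derivations
can be proved on it by induction on the construction of a function, which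
avoids the symmetry of second derivatives.  In [smooth_tower], [phi] lists a
one-variable function and its successive derivatives; this single constructor
covers inverse, logarithm, exponential and trigonometric functions. *)
Inductive smooth_on : ('cV[R]_n -> R) -> Prop :=
| smooth_coord i : smooth_on (fun x => x i 0)
| smooth_cst c : smooth_on (fun=> c)
| smooth_add f g : smooth_on f -> smooth_on g -> smooth_on (fun x => f x + g x)
| smooth_mul f g : smooth_on f -> smooth_on g -> smooth_on (fun x => f x * g x)
| smooth_tower (phi : nat -> R -> R) f k : smooth_on f ->
    (forall j x, X x -> is_derive (f x) 1 (phi j) (phi j.+1 (f x))) ->
    smooth_on (fun x => phi k (f x))
| smooth_ext f g : smooth_on f -> (forall x, X x -> f x = g x) -> smooth_on g.

Lemma smooth_differentiable f x : smooth_on f -> X x -> differentiable f x.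
Proof.
move=> sf Xx; elim: sf => {f}.
- by move=> i; exact: differentiable_coord.
- by move=> c; exact: differentiable_cst.
- by move=> f g _ df _ dg; exact: differentiableD.
- by move=> f g _ df _ dg; exact: differentiableM.
- by move=> phi f k _ df tower; exact: differentiable_chain (tower k x Xx).
- by move=> f g _ df fg; exact: eq_on_differentiable fg df.
Qed.

Lemma smooth_partial i f : smooth_on f -> smooth_on (partial i f).
Proof.
elim=> {f}.
- move=> j; apply: smooth_ext (smooth_cst (j == i)%:R) _ => x _.
  by rewrite partial_coord.
- by move=> c; apply: smooth_ext (smooth_cst 0) _ => x _; rewrite partial_cst.
- move=> f g sf df sg dg; apply: smooth_ext (smooth_add df dg) _ => x Xx.
  by rewrite partialD//; exact: smooth_differentiable.
- move=> f g sf df sg dg.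
  apply: smooth_ext (smooth_add (smooth_mul sf dg) (smooth_mul sg df)) _ => x Xx.
  by rewrite partialM//; exact: smooth_differentiable.
- move=> phi f k sf df tower.
  apply: smooth_ext (smooth_mul (smooth_tower k.+1 sf tower) df) _ => x Xx.
  by rewrite (partial_chain _ (smooth_differentiable sf Xx) (tower k x Xx)).
- move=> f g sf df fg; apply: smooth_ext df _ => x Xx.
  exact: eq_on_partial fg.
Qed.

Lemma smooth_C1 f : smooth_on f -> C1_on X f.
Proof.
move=> sf x Xx; split=> [|i]; first exact: smooth_differentiable.
apply: differentiable_continuous.
exact: smooth_differentiable (smooth_partial i sf) Xx.
Qed.

Lemma smooth_sum (I : Type) (r : seq I) (P : pred I) (F : I -> 'cV[R]_n -> R) :
  (forall i, P i -> smooth_on (F i)) ->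
  smooth_on (fun x => \sum_(i <- r | P i) F i x).
Proof.
move=> sF; elim: r => [|i r IHr].
  by apply: smooth_ext (smooth_cst 0) _ => x _; rewrite big_nil.
case Pi: (P i).
  by apply: smooth_ext (smooth_add (sF i Pi) IHr) _ => x _; rewrite big_cons Pi.
by apply: smooth_ext IHr _ => x _; rewrite big_cons Pi.
Qed.

Lemma smooth_exp f : smooth_on f -> smooth_on (fun x => expR (f x)).
Proof.
by move=> sf; apply: (smooth_tower (phi := fun=> expR) 0 sf).
Qed.

(** The derivatives of the cosine are its translates by multiples of a quarter
turn, and the sine is the opposite of the first of them. *)
Lemma smooth_cos_sin f : smooth_on f ->
  smooth_on (fun x => cos (f x)) /\ smooth_on (fun x => sin (f x)).
Proof.
move=> sf.
pose phi k (t : R) := cos (t + k%:R * (pi / 2)).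
have tower j (t : R) : is_derive t 1 (phi j) (phi j.+1 t).
  have -> : phi j.+1 t = - sin (t + j%:R * (pi / 2)).
    by rewrite /phi -addn1 natrD mulrDl mul1r addrA cosDpihalf.
  rewrite /phi; by apply: is_derive_eq; rewrite addr0 mulr1.
split.
  apply: smooth_ext (smooth_tower (phi := phi) 0 sf _) _ => // x _.
  by rewrite /phi mul0r addr0.
apply: smooth_ext (smooth_mul (smooth_cst (-1)) (smooth_tower (phi := phi) 1 sf _)) _ => // x _.
by rewrite /phi mul1r cosDpihalf mulN1r opprK.
Qed.

(** The successive derivatives of the inverse. *)
Definition inv_tower k (t : R) := (-1) ^+ k * k`!%:R * t^-1 ^+ k.+1.

Lemma is_derive_inv_tower k (t : R) : t != 0 ->
  is_derive t 1 (inv_tower k) (inv_tower k.+1 t).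
Proof.
move=> t0.
have dV : is_derive t 1 (fun u : R => u^-1) (- t ^- 2 *: 1) by exact: is_deriveV.
have -> : inv_tower k = ((-1) ^+ k * k`!%:R) *: (fun u : R => u^-1) ^+ k.+1.
  by apply/funext => u; rewrite /inv_tower !fctE.
have := is_deriveZ ((-1) ^+ k * k`!%:R) (is_deriveX k.+1 dV).
move=> H; apply: is_derive_eq.
rewrite /inv_tower factS natrM /GRing.scale /= -exprVn; set u := t^-1.
rewrite [in RHS]exprS [u ^+ k.+2]exprS [u ^+ k.+1]exprS expr2 mulr1.
move: (_ ^+ k) (u ^+ k) (k`!%:R) (k.+1%:R) => c w d e.
ring.
Qed.

Lemma smooth_inv f : smooth_on f -> (forall x, X x -> f x != 0) ->
  smooth_on (fun x => (f x)^-1).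
Proof.
move=> sf f0.
apply: smooth_ext (smooth_tower (phi := inv_tower) 0 sf _) _ => [k x Xx|x _].
  by apply: is_derive_inv_tower; exact: f0.
by rewrite /inv_tower expr0 fact0 expr1 !mul1r.
Qed.

Lemma smooth_ln f : smooth_on f -> (forall x, X x -> 0 < f x) ->
  smooth_on (fun x => ln (f x)).
Proof.
move=> sf f0.
pose phi k := if k is j.+1 then inv_tower j else @ln R.
apply: (smooth_tower (phi := phi) 0 sf) => -[|k] x Xx /=; last first.
  by apply: is_derive_inv_tower; rewrite gt_eqF ?f0.
by rewrite /inv_tower expr0 fact0 expr1 !mul1r; apply: is_derive1_ln; exact: f0.
Qed.
End SmoothFunctions.

(** * Calculus of linear vector fields *)

Section VectorFields.
Variables (R : realType) (n m : nat) (a : 'I_n -> 'I_m -> 'I_n -> R).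
Variables (X : set 'cV[R]_n) (X_open : open X).
Implicit Types (f g : 'cV[R]_n -> R) (x : 'cV[R]_n).

Lemma frakp_coord j i x : frakp a j (fun y => y i 0) x = coef_A a i j x.
Proof.
rewrite /frakp (bigD1 i)//= partial_coord eqxx mulr1 big1 ?addr0// => k ki.
by rewrite partial_coord eq_sym (negbTE ki) mulr0.
Qed.

Lemma frakp_cst j c x : frakp a j (fun=> c) x = 0.
Proof. by rewrite /frakp big1// => i _; rewrite partial_cst mulr0. Qed.

Lemma frakpD j f g x : differentiable f x -> differentiable g x ->
  frakp a j (fun y => f y + g y) x = frakp a j f x + frakp a j g x.
Proof.
move=> df dg; rewrite /frakp -big_split /=; apply: eq_bigr => i _.
by rewrite partialD// mulrDr.
Qed.

Lemma frakpM j f g x : differentiable f x -> differentiable g x ->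
  frakp a j (fun y => f y * g y) x = f x * frakp a j g x + g x * frakp a j f x.
Proof.
move=> df dg; rewrite /frakp !mulr_sumr -big_split /=; apply: eq_bigr => i _.
by rewrite partialM//; ring.
Qed.

Lemma frakp_chain j (phi : R -> R) d f x : differentiable f x ->
  is_derive (f x) 1 phi d ->
  frakp a j (fun y => phi (f y)) x = d * frakp a j f x.
Proof.
move=> df dphi; rewrite /frakp mulr_sumr; apply: eq_bigr => i _.
by rewrite (partial_chain _ df dphi); ring.
Qed.

Lemma eq_on_frakp j f g x : X x -> (forall y, X y -> f y = g y) ->
  frakp a j f x = frakp a j g x.
Proof.
move=> Xx fg; apply: eq_bigr => i _; congr (_ * _).
exact: eq_on_partial X_open Xx fg.
Qed.

Lemma frakp_sum j (I : Type) (r : seq I) (P : pred I)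
    (F : I -> 'cV[R]_n -> R) x : X x -> (forall i, P i -> smooth_on X (F i)) ->
  frakp a j (fun y => \sum_(i <- r | P i) F i y) x =
  \sum_(i <- r | P i) frakp a j (F i) x.
Proof.
move=> Xx sF; elim: r => [|i r IHr].
  rewrite big_nil -[RHS](frakp_cst j 0 x).
  by apply: eq_on_frakp => // y _; rewrite big_nil.
rewrite big_cons; case: ifPn => Pi; rewrite -IHr.
  rewrite -frakpD; [|exact: smooth_differentiable (sF i Pi) Xx|
    exact: smooth_differentiable (smooth_sum r sF) Xx].
  by apply: eq_on_frakp => // y _; rewrite big_cons Pi.
by apply: eq_on_frakp => // y _; rewrite big_cons (negbTE Pi).
Qed.

Lemma smooth_coef_A i j : smooth_on X (coef_A a i j).
Proof.
apply: smooth_sum => k _; apply: smooth_mul; first exact: smooth_cst.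
exact: smooth_coord.
Qed.

Lemma smooth_frakp j f : smooth_on X f -> smooth_on X (frakp a j f).
Proof.
move=> sf; apply: smooth_sum => i _.
by apply: smooth_mul; [exact: smooth_coef_A|exact: smooth_partial].
Qed.

(** The commutator of two derivations is a derivation, so it vanishes as soon as
it vanishes on the generators of the class of functions; on the coordinates it is
the Lie bracket of the two fields. *)
Lemma frakp_commute j l f x : completely_solvable a -> smooth_on X f -> X x ->
  frakp a j (frakp a l f) x = frakp a l (frakp a j f) x.
Proof.
move=> solv sf; elim: sf x => {f}.
- move=> i x Xx; apply/eqP; rewrite -subr_eq0; apply/eqP.
  rewrite -[RHS](solv j l i x) /lie_bracket.
  by congr (_ - _); apply: eq_on_frakp => // y _; rewrite frakp_coord.
- move=> c x Xx.
  have p0 k : frakp a k (fun=> c) = fun=> 0 by apply/funext => y; rewrite frakp_cst.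
  by rewrite !p0 !frakp_cst.
- move=> f g sf IHf sg IHg x Xx.
  have E k y : X y ->
      frakp a k (fun z => f z + g z) y = frakp a k f y + frakp a k g y.
    by move=> Xy; rewrite frakpD//; apply: smooth_differentiable Xy.
  rewrite (eq_on_frakp _ Xx (E l)) (eq_on_frakp _ Xx (E j)).
  rewrite !frakpD ?IHf ?IHg //; apply: smooth_differentiable Xx => //;
    exact: smooth_frakp.
- move=> f g sf IHf sg IHg x Xx.
  have E k y : X y ->
      frakp a k (fun z => f z * g z) y = f y * frakp a k g y + g y * frakp a k f y.
    by move=> Xy; rewrite frakpM//; apply: smooth_differentiable Xy.
  rewrite (eq_on_frakp _ Xx (E l)) (eq_on_frakp _ Xx (E j)).
  have df : differentiable f x by apply: smooth_differentiable Xx.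
  have dg : differentiable g x by apply: smooth_differentiable Xx.
  have dpf k : differentiable (frakp a k f) x.
    by apply: smooth_differentiable Xx => //; apply: smooth_frakp.
  have dpg k : differentiable (frakp a k g) x.
    by apply: smooth_differentiable Xx => //; apply: smooth_frakp.
  rewrite !frakpD; try exact: differentiableM.
  by rewrite !frakpM// IHf// IHg//; ring.
- move=> phi f k sf IHf tower x Xx.
  have E i y : X y ->
      frakp a i (fun z => phi k (f z)) y = phi k.+1 (f y) * frakp a i f y.
    move=> Xy; rewrite (frakp_chain _ _ (tower k y Xy))//.
    exact: smooth_differentiable Xy.
  rewrite (eq_on_frakp _ Xx (E l)) (eq_on_frakp _ Xx (E j)).
  have df : differentiable f x by apply: smooth_differentiable Xx.
  have dpf i : differentiable (frakp a i f) x.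
    by apply: smooth_differentiable Xx => //; apply: smooth_frakp.
  have dphi := differentiable_chain df (tower k.+1 x Xx).
  rewrite !frakpM// !(frakp_chain _ df (tower k.+1 x Xx)) IHf//.
  by ring.
- move=> f g sf IHf fg x Xx.
  have E i y : X y -> frakp a i g y = frakp a i f y.
    by move=> Xy; apply/esym/eq_on_frakp.
  by rewrite (eq_on_frakp _ Xx (E l)) (eq_on_frakp _ Xx (E j)) IHf.
Qed.
End VectorFields.

(** * Complex linear forms with real quotients *)

Section ComplexParts.
Variable R : realType.
Implicit Types z w : R[i].

Lemma Re_add z w : complex.Re (z + w) = complex.Re z + complex.Re w.
Proof. by case: z w => [? ?] [? ?]. Qed.

Lemma Im_add z w : complex.Im (z + w) = complex.Im z + complex.Im w.
Proof. by case: z w => [? ?] [? ?]. Qed.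

Lemma Re_mul z w :
  complex.Re (z * w) = complex.Re z * complex.Re w - complex.Im z * complex.Im w.
Proof. by case: z w => [? ?] [? ?]. Qed.

Lemma Im_mul z w :
  complex.Im (z * w) = complex.Re z * complex.Im w + complex.Im z * complex.Re w.
Proof. by case: z w => [? ?] [? ?]. Qed.

Lemma Re_sum (I : Type) (r : seq I) (P : pred I) (F : I -> R[i]) :
  complex.Re (\sum_(i <- r | P i) F i) = \sum_(i <- r | P i) complex.Re (F i).
Proof. exact: (big_morph _ Re_add). Qed.

Lemma Im_sum (I : Type) (r : seq I) (P : pred I) (F : I -> R[i]) :
  complex.Im (\sum_(i <- r | P i) F i) = \sum_(i <- r | P i) complex.Im (F i).
Proof. exact: (big_morph _ Im_add). Qed.

Lemma complex_parts z : z = complex.Re z +i* complex.Im z.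
Proof. by case: z. Qed.
End ComplexParts.

Section LinearForms.
Variables (R : realType) (n : nat).
Implicit Types (w u : 'cV[R]_n) (x y h : 'cV[R]_n) (nu : 'cV[R[i]]_n).

Definition rform w x : R := \sum_(i < n) w i 0 * x i 0.

Definition re_part nu : 'cV[R]_n := map_mx (@complex.Re R) nu.
Definition im_part nu : 'cV[R]_n := map_mx (@complex.Im R) nu.
Definition complexify w : 'cV[R[i]]_n := map_mx (real_complex R) w.

Lemma rformDr w x y : rform w (x + y) = rform w x + rform w y.
Proof. by rewrite -big_split; apply: eq_bigr => i _; rewrite mxE mulrDr. Qed.

Lemma rformZr w t x : rform w (t *: x) = t * rform w x.
Proof. by rewrite mulr_sumr; apply: eq_bigr => i _; rewrite mxE; ring. Qed.

Lemma rformZl w t x : rform (t *: w) x = t * rform w x.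
Proof. by rewrite mulr_sumr; apply: eq_bigr => i _; rewrite mxE; ring. Qed.

Lemma rformDl w u x : rform (w + u) x = rform w x + rform u x.
Proof. by rewrite -big_split; apply: eq_bigr => i _; rewrite mxE mulrDl. Qed.

Lemma rform_delta w i : rform w (delta_mx i 0) = w i 0.
Proof.
rewrite /rform (bigD1 i)//= mxE !eqxx mulr1 big1 ?addr0// => k ki.
by rewrite mxE (negbTE ki) mulr0.
Qed.

Lemma rform_inj w u : (forall x, rform w x = rform u x) -> w = u.
Proof. by move=> E; apply/colP => i; rewrite -!rform_delta E. Qed.

Lemma Re_lform nu x : complex.Re (lform nu x) = rform (re_part nu) x.
Proof.
by rewrite Re_sum; apply: eq_bigr => i _; rewrite Re_mul /= mulr0 subr0 !mxE.
Qed.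

Lemma Im_lform nu x : complex.Im (lform nu x) = rform (im_part nu) x.
Proof.
by rewrite Im_sum; apply: eq_bigr => i _; rewrite Im_mul /= mulr0 add0r !mxE.
Qed.

Lemma lformZ c nu x : lform (c *: nu) x = c * lform nu x.
Proof. by rewrite mulr_sumr; apply: eq_bigr => i _; rewrite mxE mulrA. Qed.

Lemma lform_complexify w x : lform (complexify w) x = (rform w x)%:C.
Proof.
by rewrite rmorph_sum; apply: eq_bigr => i _; rewrite mxE rmorphM.
Qed.

Lemma eq_parts nu nu' :
  re_part nu = re_part nu' -> im_part nu = im_part nu' -> nu = nu'.
Proof.
move=> /colP re /colP im; apply/colP => i.
have := re i; have := im i; rewrite !mxE [nu i 0]complex_parts => -> ->.
by rewrite -complex_parts.
Qed.

Lemma re_partZ (k : R) nu : re_part (k%:C *: nu) = k *: re_part nu.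
Proof. by apply/colP => i; rewrite !mxE Re_mul mul0r subr0. Qed.

Lemma im_partZ (k : R) nu : im_part (k%:C *: nu) = k *: im_part nu.
Proof. by apply/colP => i; rewrite !mxE Im_mul mul0r addr0. Qed.

Lemma complexify_re_part nu : im_part nu = 0 -> nu = complexify (re_part nu).
Proof.
by move=> nu0; apply: eq_parts; rewrite ?nu0; apply/colP => i; rewrite !mxE.
Qed.

Lemma open_symmetric_step (X : set 'cV[R]_n) x h : open X -> X x ->
  exists t : R, [/\ t != 0, X (x + t *: h) & X (x - t *: h)].
Proof.
move=> Xo Xx.
have step g : \forall t \near (0 : R), X (x + t *: g).
  have c : (x + t *: g) @[t --> (0 : R)] --> x.
    rewrite -[X in _ --> X]addr0 -(scale0r g).
    by apply: cvgD; [exact: cvg_cst|apply: cvgZr_tmp; exact: cvg_id].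
  by apply: c; exact: open_nbhs_nbhs.
have /nbhs_ballP[e /= e0 eX] : nbhs (0 : R)
    [set t | X (x + t *: h) /\ X (x + t *: - h)].
  exact: filterI (step h) (step (- h)).
have [|Xp Xm] := eX (e / 2).
  rewrite -ball_normE /= sub0r normrN gtr0_norm ?divr_gt0//.
  by rewrite ltr_pdivrMr// ltr_pMr// ltr1n.
exists (e / 2); split; [|exact: Xp|by rewrite -scalerN; exact: Xm].
by rewrite mulf_neq0 ?gt_eqF// invr_gt0.
Qed.

Lemma rform_eq0_on_open (X : set 'cV[R]_n) w : open X -> X !=set0 ->
  (forall x, X x -> rform w x = 0) -> w = 0.
Proof.
move=> Xo [x0 Xx0] w0; apply: rform_inj => h.
have [t [t0 Xp _]] := open_symmetric_step h Xo Xx0.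
have := w0 _ Xp; rewrite rformDr rformZr w0// add0r => /eqP.
rewrite mulf_eq0 (negbTE t0) /= => /eqP ->.
by rewrite /rform big1// => i _; rewrite mxE mul0r.
Qed.

(** A point where neither form vanishes is obtained by adding a point where the
first one does not vanish to a point where the second one does not. *)
Lemma rform_mul_eq0 w u : (forall h, rform w h * rform u h = 0) -> w = 0 \/ u = 0.
Proof.
move=> wu; have [->|w0] := eqVneq w 0; [by left|right].
have z0 : rform (0 : 'cV[R]_n) = fun=> 0.
  by apply/funext => h; rewrite /rform big1// => i _; rewrite mxE mul0r.
have [a wa0] : exists a, rform w a != 0.
  apply/not_existsP => wE; case/eqP: w0; apply: rform_inj => h.
  by rewrite z0; apply/eqP/negPn/negP/wE.
have ua0 : rform u a = 0.
  by apply/eqP; have /eqP := wu a; rewrite mulf_eq0 (negbTE wa0).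
apply: rform_inj => h; rewrite z0; apply/eqP; have /eqP := wu h.
rewrite mulf_eq0 => /orP[/eqP wh0|//].
have /eqP := wu (a + h); rewrite !rformDr ua0 wh0 addr0 add0r mulf_eq0.
by rewrite (negbTE wa0).
Qed.

(** The two complex linear forms [al0 + i be0] and [al1 + i be1] have a real
quotient on [X].  The product identity is quadratic; comparing its values at the
two ends of a segment centred at [x0] separates its part of degree one, which
gives [be1 = k be0], from its part of degree two, which then says that
[(al1 - k al0) be0] vanishes identically. *)
Lemma proportional_quotient (X : set 'cV[R]_n) x0 (al0 be0 al1 be1 : 'cV[R]_n) :
  open X -> X x0 ->
  (forall x, X x -> rform al1 x * rform be0 x = rform al0 x * rform be1 x) ->
  rform al0 x0 = 1 -> rform be0 x0 = 0 ->
  be0 = 0 \/ exists k, al1 = k *: al0 /\ be1 = k *: be0.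
Proof.
move=> Xo Xx0 Q al00 be00; pose k := rform al1 x0.
have be10 : rform be1 x0 = 0 by have := Q _ Xx0; rewrite al00 be00 mulr0 mul1r.
have pol h : k * rform be0 h = rform be1 h /\
             rform al1 h * rform be0 h = rform al0 h * rform be1 h.
  have [t [t0 Xp Xm]] := open_symmetric_step h Xo Xx0.
  have := Q _ Xp; have := Q _ Xm.
  rewrite -scaleNr !rformDr !rformZr al00 be00 be10 -/k !add0r => Em Ep.
  split; apply: (mulfI t0); last apply: (mulfI t0); lra.
have be1E : be1 = k *: be0.
  by apply: rform_inj => h; rewrite rformZl; case: (pol h).
have [|al1E|->] := @rform_mul_eq0 (al1 - k *: al0) be0; last by left.
  move=> h; rewrite rformDl -scaleNr rformZl mulrDl.
  have [p1 p2] := pol h; rewrite p2 -p1; ring.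
by right; exists k; split=> //; apply/eqP; rewrite -subr_eq0 al1E.
Qed.

Lemma rform_continuous w : continuous (rform w).
Proof.
move=> x; apply: differentiable_continuous.
apply: (smooth_differentiable (X := setT)) => //; first exact: openT.
by apply: smooth_sum => i _; apply: smooth_mul; [exact: smooth_cst|exact: smooth_coord].
Qed.

Lemma rform_gt0_connected (X : set 'cV[R]_n) w x0 : connected X -> X x0 ->
  (forall x, X x -> rform w x != 0) -> 0 < rform w x0 ->
  forall x, X x -> 0 < rform w x.
Proof.
move=> Xc Xx0 w0 wx0 x Xx; rewrite ltNge; apply/negP => wx.
have : connected [set rform w y | y in X].
  apply: connected_continuous_connected => //.
  exact: continuous_subspaceT (@rform_continuous w).
move/connected_intervalP => /(_ (rform w x) (rform w x0)) itv.
have [| | |y Xy /eqP] := itv _ _ 0; [by exists x|by exists x0| | ].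
  by rewrite wx ltW.
by rewrite (negbTE (w0 y Xy)).
Qed.

(** Because the functions [v] are real, a chain is a chain of real vectors up to
one complex factor, namely the value at some point of the first linear form.
Normalized by this factor, the first two forms have a real quotient; they are not
proportional, so the first one is real by [proportional_quotient].  The triangular
system then shows that the next forms take real values on an open set.  The first
form does not vanish on the connected set [X], and it is 1 at the chosen point, so
it is positive. *)
Lemma common_phase (X : set 'cV[R]_n) (s : nat) (nu : nat -> 'cV[R[i]]_n)
    (v : nat -> 'cV[R]_n -> R) :
  is_domain X -> (2 <= s)%N ->
  (forall x, X x -> lform (nu 0%N) x != 0) ->
  (forall k, nu 1%N <> k *: nu 0%N) ->
  (forall theta, (0 < theta < s)%N -> forall x, X x ->
     lform (nu theta) x = \sum_(1 <= delta < theta.+1)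
       'C(theta.-1, delta.-1)%:R * (v delta x)%:C * lform (nu (theta - delta)%N) x) ->
  exists c (w : nat -> 'cV[R]_n), [/\ c != 0,
    forall theta, (theta < s)%N -> nu theta = c *: complexify (w theta)
    & forall x, X x -> 0 < rform (w 0%N) x].
Proof.
move=> [Xo Xc X0] s2 nu0 nu1 vsol; have [x0 Xx0] := X0.
pose c := lform (nu 0%N) x0; have c0 : c != 0 by exact: nu0.
pose nu' theta := c^-1 *: nu theta; pose w theta := re_part (nu' theta).
have nuE theta : nu theta = c *: nu' theta by rewrite scalerA mulfV// scale1r.
have vsol' theta : (0 < theta < s)%N -> forall x, X x ->
    lform (nu' theta) x = \sum_(1 <= delta < theta.+1)
      'C(theta.-1, delta.-1)%:R * (v delta x)%:C * lform (nu' (theta - delta)%N) x.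
  move=> ths x Xx; rewrite lformZ vsol// mulr_sumr; apply: eq_bigr => d _.
  by rewrite lformZ mulrCA.
have x0E : lform (nu' 0%N) x0 = 1 by rewrite lformZ mulVf.
have im0 : im_part (nu' 0%N) = 0.
  have [| | |//|[k [alE beE]]] := @proportional_quotient X x0 (w 0%N) (im_part (nu' 0%N))
      (w 1%N) (im_part (nu' 1%N)) Xo Xx0.
  - move=> x Xx; rewrite -!Re_lform -!Im_lform (vsol' 1%N)// big_nat1 mul1r subnn.
    by rewrite Re_mul Im_mul /= !mul0r subr0 addr0; ring.
  - by rewrite -Re_lform x0E.
  - by rewrite -Im_lform x0E.
  have nu'1 : nu' 1%N = k%:C *: nu' 0%N; last first.
    case: (nu1 k%:C); rewrite (nuE 1%N) nu'1 scalerA mulrC -scalerA.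
    by rewrite -nuE.
  by apply: eq_parts; rewrite ?re_partZ ?im_partZ.
have im theta : (theta < s)%N -> im_part (nu' theta) = 0.
  elim/ltn_ind: theta => -[//|theta] IH ths.
  apply: (rform_eq0_on_open Xo X0) => x Xx; rewrite -Im_lform vsol'// Im_sum.
  rewrite big_nat_cond big1// => d /andP[/andP[d1 d2] _].
  have imd : im_part (nu' (theta.+1 - d)%N) = 0.
    apply: IH; first by rewrite ltn_subrL d1.
    by apply: leq_ltn_trans ths; rewrite leq_subr.
  rewrite (complexify_re_part imd) lform_complexify.
  by rewrite -(rmorph_nat (real_complex R)) -!rmorphM.
exists c, w; split=> // [theta ths|].
  by rewrite nuE (complexify_re_part (im _ ths)).
apply: (@rform_gt0_connected X _ x0) => // [x Xx|]; last first.
  by rewrite -Re_lform x0E.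
have := nu0 x Xx; rewrite nuE (complexify_re_part im0) lformZ lform_complexify.
by rewrite mulf_eq0 (negbTE c0) /=; apply: contraNneq => ->.
Qed.
End LinearForms.

(** * Chains of real vectors and their quotients *)

Section RealMatrices.
Variables (R : realType) (n m : nat) (a : 'I_n -> 'I_m -> 'I_n -> R).
Implicit Types (w u : 'cV[R]_n) (x : 'cV[R]_n).

Definition realA (j : 'I_m) : 'M[R]_n := \matrix_(i, xi) a xi j i.

Lemma complexify_inj : injective (@complexify R n).
Proof. exact: map_mx_inj. Qed.

Lemma complexifyD w u : complexify (w + u) = complexify w + complexify u.
Proof. exact: map_mxD. Qed.

Lemma complexifyZ k w : complexify (k *: w) = k%:C *: complexify w.
Proof. exact: map_mxZ. Qed.

Lemma mxA_complexify j w : mxA a j *m complexify w = complexify (realA j *m w).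
Proof.
rewrite /complexify map_mxM; congr (_ *m _).
by apply/matrixP => i k; rewrite !mxE.
Qed.

Lemma smooth_rform (X : set 'cV[R]_n) w : smooth_on X (rform w).
Proof.
by apply: smooth_sum => i _; apply: smooth_mul; [exact: smooth_cst|exact: smooth_coord].
Qed.

(** On linear forms the derivation acts by the matrix of the field; this is the
reason for the transposition in the definition of the matrices. *)
Lemma frakp_rform j w x : frakp a j (rform w) x = rform (realA j *m w) x.
Proof.
pose F i (y : 'cV[R]_n) := w i 0 * y i 0.
have sF i : smooth_on setT (F i).
  by apply: smooth_mul; [exact: smooth_cst|exact: smooth_coord].
rewrite -[rform w]/(fun y => \sum_(i < n) F i y).
rewrite (frakp_sum a openT)//.
transitivity (\sum_(i < n) \sum_(k < n) a i j k * x k 0 * w i 0).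
  apply: eq_bigr => i _; rewrite frakpM ?frakp_cst ?frakp_coord.
  - by rewrite mulr0 addr0 mulr_sumr; apply: eq_bigr => k _; rewrite mulrC.
  - exact: differentiable_cst.
  - exact: differentiable_coord.
rewrite exchange_big; apply: eq_bigr => k _; rewrite !mxE mulr_suml.
by apply: eq_bigr => i _; rewrite mxE mulrAC.
Qed.

Lemma real_eigenvalue j w c lam : c != 0 -> w != 0 ->
  mxA a j *m (c *: complexify w) = lam *: (c *: complexify w) ->
  lam = (complex.Re lam)%:C /\ realA j *m w = complex.Re lam *: w.
Proof.
move=> c0 w0; rewrite -scalemxAr [in RHS]scalerA mulrC -scalerA.
move/(scalerI c0); rewrite mxA_complexify => E.
have Ei i : ((realA j *m w) i 0)%:C = lam * (w i 0)%:C.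
  have := congr1 (fun M : 'cV[R[i]]_n => M i 0) E.
  by rewrite /complexify [LHS]mxE [RHS]mxE [map_mx _ w _ _]mxE.
split.
  have [i wi0] : exists i, w i 0 != 0.
    apply/not_existsP => wE; case/eqP: w0; apply/colP => i; rewrite mxE.
    by apply/eqP/negPn/negP/wE.
  have /(congr1 (@complex.Im R)) := Ei i; rewrite Im_mul /= mulr0 add0r => /esym/eqP.
  rewrite mulf_eq0 (negbTE wi0) orbF => /eqP lam0.
  by rewrite [LHS]complex_parts lam0.
apply/colP => i; have /(congr1 (@complex.Re R)) := Ei i.
by rewrite Re_mul /= mulr0 subr0 => ->; rewrite mxE.
Qed.

Lemma real_chain j w u c (l : R) k : c != 0 ->
  (mxA a j - (l%:C)%:M) *m (c *: complexify w) = k%:R *: (c *: complexify u) ->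
  realA j *m w = l *: w + k%:R *: u.
Proof.
move=> c0; rewrite -scalemxAr [in RHS]scalerA mulrC -scalerA.
move/(scalerI c0); rewrite mulmxBl mul_scalar_mx mxA_complexify.
move/eqP; rewrite subr_eq addrC => /eqP E; apply: complexify_inj.
by rewrite E complexifyD !complexifyZ rmorph_nat.
Qed.
End RealMatrices.

Section ChainQuotients.
Variables (R : realType) (n m : nat) (a : 'I_n -> 'I_m -> 'I_n -> R).
Variables (X : set 'cV[R]_n) (X_open : open X) (s : nat).
Variables (w : nat -> 'cV[R]_n) (v : nat -> 'cV[R]_n -> R).
Hypothesis w0_gt0 : forall x, X x -> 0 < rform (w 0%N) x.
Hypothesis v_system : forall t, (t.+1 < s)%N -> forall x, X x ->
  rform (w t.+1) x = \sum_(d < t.+1) 'C(t, d)%:R * v d.+1 x * rform (w (t - d)%N) x.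

(** The system is triangular with diagonal coefficient the positive form
[rform (w 0)], so it can be solved for its last unknown. *)
Lemma smooth_quotient t : (t.+1 < s)%N -> smooth_on X (v t.+1).
Proof.
elim/ltn_ind: t => t IH ts.
have w0_inv : smooth_on X (fun x => (rform (w 0%N) x)^-1).
  by apply: smooth_inv (smooth_rform _ _) _ => x Xx; rewrite gt_eqF ?w0_gt0.
pose S (x : 'cV[R]_n) := \sum_(d < t) 'C(t, d)%:R * v d.+1 x * rform (w (t - d)%N) x.
have sS : smooth_on X S.
  apply: smooth_sum => d _; apply: smooth_mul (smooth_rform _ _).
  apply: smooth_mul (smooth_cst _ _) _; apply: IH => //.
  exact: leq_ltn_trans (ltn_ord d) (ltnW ts).
apply: smooth_ext (smooth_mul (smooth_add (smooth_rform X (w t.+1))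
  (smooth_mul (smooth_cst X (-1)) sS)) w0_inv) _ => x Xx.
rewrite v_system// big_ord_recr /= binn subnn mul1r mulN1r -/(S x) [S x + _]addrC addrK.
by rewrite mulfK// gt_eqF ?w0_gt0.
Qed.

(** Applying the derivation to the equation of index [t + 1] of the system and
using the chain relation on every linear form, the terms with [l] reproduce the
same equation, and the terms that lower the index of a vector reproduce [t] times
the equation of index [t], because
['C(t, d) * (t - d) = t * 'C(t - 1, d)].  What remains is a triangular system for
the derivatives of the [v d], which has the solution 1, 0, 0 and so on. *)
Lemma frakp_quotient zeta (l : R) t x :
  (forall k, (k < s)%N -> realA a zeta *m w k = l *: w k + k%:R *: w k.-1) ->
  (t.+1 < s)%N -> X x -> frakp a zeta (v t.+1) x = (t == 0%N)%:R.
Proof.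
move=> chain; elim/ltn_ind: t x => t IH x ts Xx.
have pw k : (k < s)%N -> frakp a zeta (rform (w k)) x =
    l * rform (w k) x + k%:R * rform (w k.-1) x.
  by move=> ks; rewrite frakp_rform chain// rformDl !rformZl.
have sv (d : 'I_t.+1) : smooth_on X (v d.+1).
  by apply: smooth_quotient; exact: leq_ltn_trans (ltn_ord d) ts.
have main : rform (w t) x =
    \sum_(d < t.+1) 'C(t, d)%:R * frakp a zeta (v d.+1) x * rform (w (t - d)%N) x.
  have := pw _ ts.
  rewrite (eq_on_frakp a X_open zeta Xx (v_system ts)) (frakp_sum a X_open)//; last first.
    move=> d _; apply: smooth_mul (smooth_rform _ _).
    exact: smooth_mul (smooth_cst _ _) (sv d).
  have dw k : differentiable (rform (w k)) x.
    exact: (smooth_differentiable X_open (smooth_rform X _) Xx).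
  have dv (d : 'I_t.+1) : differentiable (v d.+1) x.
    exact: (smooth_differentiable X_open (sv d) Xx).
  have dcv (d : 'I_t.+1) : differentiable (fun y => 'C(t, d)%:R * v d.+1 y) x.
    exact: (smooth_differentiable X_open (smooth_mul (smooth_cst X _) (sv d)) Xx).
  under eq_bigr => d _.
    rewrite frakpM//.
    rewrite frakpM ?frakp_cst//.
    rewrite pw; last by apply: leq_ltn_trans (ltnW ts); rewrite leq_subr.
    over.
  pose T1 (d : 'I_t.+1) := 'C(t, d)%:R * v d.+1 x * rform (w (t - d)%N) x.
  pose T2 (d : 'I_t.+1) := 'C(t, d)%:R * frakp a zeta (v d.+1) x * rform (w (t - d)%N) x.
  pose T3 (d : 'I_t.+1) :=
    ('C(t, d) * (t - d))%:R * v d.+1 x * rform (w (t - d).-1) x.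
  rewrite (eq_bigr (fun d => l * T1 d + (T2 d + T3 d))); last first.
    by move=> d _; rewrite /T1 /T2 /T3 natrM; ring.
  rewrite big_split -mulr_sumr -v_system//= => /addrI; rewrite big_split /=.
  suff -> : \sum_(d < t.+1) T3 d = t%:R * rform (w t) x.
    by rewrite -natr1 mulrDl mul1r addrC => /addrI/esym.
  case: t ts {IH sv dv dcv T1 T2} @T3 => [|u] us T3.
    by rewrite big_ord1 /T3 subn0 muln0 !mul0r.
  rewrite big_ord_recr /= /T3 subnn muln0 !mul0r addr0 v_system ?(ltnW us)//.
  rewrite mulr_sumr; apply: eq_bigr => d _ /=.
  have du : (d <= u)%N by rewrite -ltnS.
  by rewrite mulnC -mul_bin_down natrM subSn//= !mulrA.
(* Only the term of index [t] of the equation [main] is not known by induction. *)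
suff : (frakp a zeta (v t.+1) x - (t == 0%N)%:R) * rform (w 0%N) x = 0.
  move/eqP; rewrite mulf_eq0 subr_eq0 => /orP[/eqP//|].
  by rewrite gt_eqF// w0_gt0.
have : \sum_(d < t.+1) 'C(t, d)%:R * (frakp a zeta (v d.+1) x - (d == 0%N :> nat)%:R) *
    rform (w (t - d)%N) x = 0.
  under eq_bigr do rewrite mulrBr mulrBl.
  rewrite sumrB -main big_ord_recl /= bin0 subn0 !mul1r big1 ?addr0 ?subrr//.
  by move=> d _; rewrite mulr0 mul0r.
rewrite big_ord_recr /= binn subnn mul1r big1 ?add0r// => d _.
rewrite IH ?subrr ?mulr0 ?mul0r//.
exact: leq_ltn_trans (ltn_ord d) (ltnW ts).
Qed.
End ChainQuotients.

(** * Existence of the exponents *)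

Section Counting.
Variables (r m : nat).

Lemma sum_ord_lt_recr k (kr : (k < r)%N) (F : 'I_r -> nat) :
  (\sum_(xi < r | (xi < k.+1)%N) F xi =
   \sum_(xi < r | (xi < k)%N) F xi + F (Ordinal kr))%N.
Proof.
rewrite (bigD1 (Ordinal kr)) ?ltnS//= addnC; congr (_ + _)%N.
by apply: eq_bigl => xi; rewrite -val_eqE /= ltnS ltn_neqAle andbC.
Qed.

Lemma sum_succ_lt k (F : 'I_r -> nat) : (k <= r)%N ->
  (\sum_(xi < r | (xi < k)%N) (F xi).+1 =
   \sum_(xi < r | (xi < k)%N) F xi + k)%N.
Proof.
move=> kr; under eq_bigr do rewrite -addn1.
rewrite big_split /=; congr (_ + _)%N.
by rewrite (big_ord_narrow kr) sum1_card card_ord.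
Qed.

(** Fill the blocks one after the other: each block but the last one is taken
completely, and the last one is truncated to reach the total [N]. *)
Lemma greedy_orders (s : 'I_r -> nat) N k : (forall xi, 0 < s xi)%N ->
  (k <= r)%N -> (N <= \sum_(xi < r | (xi < k)%N) s xi)%N ->
  exists k' (eps : 'I_r -> nat), [/\ (k' <= r)%N,
    (\sum_(xi < r | (xi < k')%N) (eps xi).+1 = N)%N
    & forall xi, (eps xi <= s xi - 1)%N].
Proof.
move=> s_gt0; elim: k => [|k IH] kr.
  rewrite big_pred0// leqn0 => /eqP ->; exists 0%N, (fun=> 0%N).
  by split=> //; rewrite big_pred0.
rewrite (sum_ord_lt_recr kr) => NS.
have [Nk|kN] := leqP N (\sum_(xi < r | (xi < k)%N) s xi).
  exact: IH (ltnW kr) Nk.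
set S := (\sum_(xi < r | (xi < k)%N) s xi)%N in NS kN.
exists k.+1, (fun xi : 'I_r => if (xi < k)%N then s xi - 1 else
  if (xi == k :> nat) then N - S - 1 else 0)%N; split=> //.
  rewrite (sum_ord_lt_recr kr) /= ltnn eqxx.
  rewrite (eq_bigr s) => [|xi xik]; last by rewrite xik subn1 prednK.
  by rewrite -/S; lia.
move=> xi; case: ifP => // _; case: eqP => // xik.
have -> : xi = Ordinal kr by apply: val_inj.
by lia.
Qed.

Lemma exists_admissible_orders (s : 'I_r -> nat) : (forall xi, 2 <= s xi)%N ->
  (m + 1 <= \sum_(xi < r) s xi)%N -> exists k eps, admissible_orders m s k eps.
Proof.
move=> s2 ms.
have [|||k [eps [kr sum_eps eps_s]]] := @greedy_orders s m.+1 r.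
- by move=> xi; apply: leq_trans (s2 xi).
- by [].
- rewrite -addn1 (eq_bigl predT)// => xi; exact: ltn_ord.
by exists k, eps; split=> //; rewrite -sum_succ_lt.
Qed.
End Counting.

Lemma exists_dependence (F : fieldType) (T : finType) (P : pred T) m
    (G : T -> 'I_m -> F) : (m < #|P|)%N ->
  exists u : T -> F, (exists2 t, P t & u t != 0) /\
    forall j, \sum_(t | P t) u t * G t j = 0.
Proof.
move=> mP; pose M : 'M[F]_(#|P|, m) := \matrix_(i, j) G (enum_val i) j.
have : kermx M != 0.
  rewrite -mxrank_eq0 mxrank_ker subn_eq0 -ltnNge.
  exact: leq_ltn_trans (rank_leq_col _) mP.
case/rowV0Pn => y /sub_kermxP yM y0.
pose u t := \sum_(i | enum_val i == t) y 0 i.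
have uE i : u (enum_val i) = y 0 i.
  rewrite /u (bigD1 i)//= big1 ?addr0// => k /andP[/eqP/enum_val_inj ->].
  by rewrite eqxx.
exists u; split=> [|j].
  have /rV0Pn[i yi] := y0.
  by exists (enum_val i); [exact: (enum_valP i)|rewrite uE].
have := congr1 (fun M : 'rV[F]_m => M 0 j) yM; rewrite !mxE => E.
transitivity (\sum_(t in P) u t * G t j); first by apply: eq_bigl.
rewrite big_enum_val /= -[RHS]E; apply: eq_bigr => i _.
by rewrite uE mxE.
Qed.

(** An admissible choice of orders gives [m + 1] unknowns for [m] equations. *)
Lemma exists_nontrivial_solution (R : realType) (r m : nat)
    (lam : 'I_r -> 'I_m -> R) (mu : 'I_r -> nat -> 'I_m -> R) s k eps :
  admissible_orders m s k eps ->
  exists h : 'I_r -> nat -> R,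
    nontrivial_solution (fun xi j => (lam xi j)%:C) mu k eps
      (fun xi q => (h xi q)%:C).
Proof.
move=> [kr sum_eps _].
have eps_lt (xi : 'I_r) : (xi < k)%N -> (eps xi < m.+2)%N.
  move=> xik; rewrite ltnS -sum_eps (bigD1 xi)//= -addnA leq_addr//.
pose P (p : 'I_r * 'I_m.+2) := (p.1 < k)%N && (p.2 <= eps p.1)%N.
pose G (p : 'I_r * 'I_m.+2) j :=
  if p.2 == 0%N :> nat then lam p.1 j else mu p.1 p.2 j.
have sumP (V : nmodType) (H : 'I_r -> nat -> V) :
    \sum_(p | P p) H p.1 p.2 =
    \sum_(xi < r | (xi < k)%N) \sum_(0 <= q < (eps xi).+1) H xi q.
  rewrite -(pair_big_dep (fun xi : 'I_r => (xi < k)%N)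
    (fun xi (q : 'I_m.+2) => (q <= eps xi)%N) (fun xi q => H xi q)) /=.
  apply: eq_bigr => xi xik; rewrite big_mkord.
  rewrite (big_ord_widen m.+2 (H xi))//; first exact: eps_lt.
have cardP : #|P| = m.+1.
  rewrite -sum1_card (sumP _ (fun _ _ => 1%N)) -sum_eps -sum_succ_lt//.
  by apply: eq_bigr => xi _; rewrite big_mkord sum1_card card_ord.
have [|u [[p Pp up] uG]] := @exists_dependence R _ P m G.
  by rewrite cardP.
pose h xi q := u (xi, inord q).
exists h; split.
  have /andP[p1 p2] := Pp.
  exists p.1, p.2; split=> //; rewrite /h inord_val -surjective_pairing.
  by rewrite fmorph_eq0.
move=> j.
have := uG j; pose H xi q := h xi q * (if q == 0%N then lam xi j else mu xi q j).
rewrite (eq_bigr (fun p : 'I_r * 'I_m.+2 => H p.1 p.2)) => [|q _]; last first.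
  by rewrite /H /h /G inord_val -surjective_pairing.
rewrite sumP => /(congr1 (real_complex R)); rewrite rmorph0 rmorph_sum /= => E.
rewrite -[RHS]E; apply: eq_bigr => xi _.
rewrite [in RHS]big_nat_recl// rmorphD big_add1 /= rmorph_sum /H.
rewrite eqxx mulrC rmorphM; congr (_ + _); apply: eq_bigr => q _.
by rewrite mulrC rmorphM.
Qed.

(** * Complex exponential and first integrals *)

Section ComplexExponential.
Variable R : realType.
Implicit Types z w c : R[i].

Lemma cexpD z w : cexp (z + w) = cexp z * cexp w.
Proof.
case: z w => [x y] [x' y']; rewrite /cexp /= expRD cosD sinD.
by apply/eqP; rewrite eq_complex /=; apply/andP; split; apply/eqP; ring.
Qed.

Lemma cexp0 : cexp (0 : R[i]) = 1.
Proof. by rewrite /cexp /= expR0 cos0 sin0 mulr0 mulr1. Qed.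

Lemma prod_cexp (I : Type) (r : seq I) (P : pred I) (F : I -> R[i]) :
  \prod_(i <- r | P i) cexp (F i) = cexp (\sum_(i <- r | P i) F i).
Proof. by rewrite (big_morph _ cexpD cexp0). Qed.

Lemma cmod_gt0 c : c != 0 -> 0 < cmod c.
Proof.
case: c => x y; rewrite eq_complex /= negb_and /cmod /= => xy.
rewrite sqrtr_gt0 lt_def addr_ge0 ?sqr_ge0// andbT.
by rewrite paddr_eq0 ?sqr_ge0// !sqrf_eq0 negb_and.
Qed.

(** The principal argument is constant along an open half-line from the origin, so
no branch cut is met there, even when the half-line is the cut itself. *)
Lemma clog_ray c (t : R) : c != 0 -> 0 < t ->
  clog (c * t%:C) = clog c + (ln t)%:C.
Proof.
move=> c0 t0; have cE : cmod (c * t%:C) = cmod c * t.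
  rewrite /cmod Re_mul Im_mul /= !mulr0 subr0 add0r !exprMn -mulrDl.
  by rewrite sqrtrM ?addr_ge0 ?sqr_ge0// sqrtr_sqr gtr0_norm.
have cargE : carg (c * t%:C) = carg c.
  rewrite /carg cE Re_mul Im_mul /= !mulr0 subr0 add0r pmulr_lge0//.
  by rewrite -mulf_div divff ?mulr1// gt_eqF.
rewrite /clog cE cargE lnM ?posrE ?cmod_gt0//.
by apply/eqP; rewrite eq_complex /= !eqxx addr0 eqxx.
Qed.
End ComplexExponential.

Section FirstIntegral.
Variables (R : realType) (n m r : nat) (a : 'I_n -> 'I_m -> 'I_n -> R).
Variables (X : set 'cV[R]_n) (X_open : open X).
Variables (w : 'I_r -> 'cV[R]_n) (v : 'I_r -> nat -> 'cV[R]_n -> R).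
Variables (lam : 'I_r -> 'I_m -> R) (mu : 'I_r -> nat -> 'I_m -> R).
Variables (k : nat) (eps : 'I_r -> nat).
Hypothesis w_gt0 : forall xi x, X x -> 0 < rform (w xi) x.
Hypothesis w_eigen : forall xi j, realA a j *m w xi = lam xi j *: w xi.
Hypothesis smooth_v : forall (xi : 'I_r) q, (xi < k)%N -> (q < eps xi)%N ->
  smooth_on X (v xi q.+1).
Hypothesis frakp_v : forall (xi : 'I_r) q j x, (xi < k)%N -> (q < eps xi)%N ->
  X x -> frakp a j (v xi q.+1) x = mu xi q.+1 j.

(** With [g] the real parts, or the imaginary parts, of the exponents, this is the
real part, or the imaginary part, of a logarithm of the first integral. *)
Definition log_combination (K : R) (g : 'I_r -> nat -> R) (x : 'cV[R]_n) : R :=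
  K + \sum_(xi < r | (xi < k)%N)
        (g xi 0%N * ln (rform (w xi) x) +
         \sum_(q < eps xi) g xi q.+1 * v xi q.+1 x).

Lemma smooth_log_term (g : R) xi : smooth_on X (fun x => g * ln (rform (w xi) x)).
Proof.
apply: smooth_mul (smooth_cst _ _) _.
by apply: smooth_ln (smooth_rform _ _) _ => x; exact: w_gt0.
Qed.

Lemma smooth_v_term (g : R) xi (q : 'I_(eps xi)) : (xi < k)%N ->
  smooth_on X (fun x => g * v xi q.+1 x).
Proof. by move=> xik; apply: smooth_mul (smooth_cst _ _) _; exact: smooth_v. Qed.

Lemma smooth_log_summand (g : 'I_r -> nat -> R) (xi : 'I_r) : (xi < k)%N ->
  smooth_on X (fun x => g xi 0%N * ln (rform (w xi) x) +
    \sum_(q < eps xi) g xi q.+1 * v xi q.+1 x).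
Proof.
move=> xik; apply: smooth_add; first exact: smooth_log_term.
by apply: smooth_sum => q _; exact: smooth_v_term.
Qed.

Lemma smooth_log_combination K g : smooth_on X (log_combination K g).
Proof.
apply: smooth_add (smooth_cst _ _) _.
by apply: smooth_sum => xi; exact: smooth_log_summand.
Qed.

(** The derivative of the logarithm of an eigenform is the eigenvalue, and that of
[v xi q] is [mu xi q j]: the result is the left-hand side of the equation of
index [j] of the linear system for the exponents. *)
Lemma frakp_log_combination K g j x : X x ->
  frakp a j (log_combination K g) x =
  \sum_(xi < r | (xi < k)%N)
     (lam xi j * g xi 0%N + \sum_(q < eps xi) mu xi q.+1 j * g xi q.+1).
Proof.
move=> Xx; rewrite /log_combination frakpD; last 2 first.
- exact: differentiable_cst.
- apply: (smooth_differentiable X_open _ Xx).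
  by apply: smooth_sum => xi; exact: smooth_log_summand.
rewrite frakp_cst add0r (frakp_sum a X_open)//; last first.
  by move=> xi; exact: smooth_log_summand.
apply: eq_bigr => xi xik; rewrite frakpD; last 2 first.
- exact: (smooth_differentiable X_open (smooth_log_term _ _) Xx).
- apply: (smooth_differentiable X_open _ Xx).
  by apply: smooth_sum => q _; exact: smooth_v_term.
have dw : differentiable (rform (w xi)) x.
  exact: (smooth_differentiable X_open (smooth_rform X _) Xx).
have dln := is_derive1_ln (w_gt0 xi Xx).
congr (_ + _).
  rewrite frakpM ?frakp_cst; last 2 first.
  - exact: differentiable_cst.
  - exact: differentiable_chain dln.
  rewrite (frakp_chain _ _ dw dln) frakp_rform w_eigen rformZl mulr0 addr0.
  by rewrite [_^-1 * _]mulrCA mulVf ?gt_eqF ?w_gt0// mulr1 mulrC.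
rewrite (frakp_sum a X_open)//; last by move=> q _; exact: smooth_v_term.
apply: eq_bigr => q _; rewrite frakpM ?frakp_cst; last 2 first.
- exact: differentiable_cst.
- exact: (smooth_differentiable X_open (smooth_v xik (ltn_ord q)) Xx).
by rewrite frakp_v// mulr0 addr0 mulrC.
Qed.

Lemma exp_first_integral (G1 G2 : 'cV[R]_n -> R) (F : 'cV[R]_n -> R[i]) :
  smooth_on X G1 -> smooth_on X G2 ->
  (forall j x, X x -> frakp a j G1 x = 0) ->
  (forall j x, X x -> frakp a j G2 x = 0) ->
  (forall x, X x -> F x = cexp (G1 x +i* G2 x)) ->
  autonomous_first_integral a X F.
Proof.
move=> sG1 sG2 pG1 pG2 FE.
have [sc ss] := smooth_cos_sin sG2.
have se := smooth_exp sG1.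
have sF1 : smooth_on X (fun x => complex.Re (F x)).
  by apply: smooth_ext (smooth_mul se sc) _ => x Xx; rewrite FE.
have sF2 : smooth_on X (fun x => complex.Im (F x)).
  by apply: smooth_ext (smooth_mul se ss) _ => x Xx; rewrite FE.
split; [exact: smooth_C1|exact: smooth_C1|move=> j x Xx].
have d (f : 'cV[R]_n -> R) : smooth_on X f -> differentiable f x.
  by move=> sf; exact: (smooth_differentiable X_open sf Xx).
have E1 y : X y -> complex.Re (F y) = expR (G1 y) * cos (G2 y).
  by move=> Xy; rewrite FE.
have E2 y : X y -> complex.Im (F y) = expR (G1 y) * sin (G2 y).
  by move=> Xy; rewrite FE.
rewrite (eq_on_frakp a X_open j Xx E1) (eq_on_frakp a X_open j Xx E2).
have de := d _ se; have dc := d _ sc; have ds := d _ ss.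
rewrite !frakpM//.
rewrite (frakp_chain a j (d _ sG1) (is_derive_expR _)).
rewrite (frakp_chain a j (d _ sG2) (is_derive_cos _)).
rewrite (frakp_chain a j (d _ sG2) (is_derive_sin _)).
by rewrite pG1// pG2// !mulr0 addr0.
Qed.
End FirstIntegral.

(** * Autonomous first integrals from generalized eigenvectors *)

Theorem theorem2p4 (R : realType) (n m r : nat)
    (a : 'I_n -> 'I_m -> 'I_n -> R) (zeta : 'I_m)
    (nu : 'I_r -> nat -> 'cV[R[i]]_n) (lam : 'I_r -> 'I_m -> R[i])
    (s : 'I_r -> nat) (X : set 'cV[R]_n)
    (v : 'I_r -> nat -> 'cV[R]_n -> R)
    (a_solvable : completely_solvable a)
    (zeta_min : forall j : 'I_m,
       (size (elementary_divisors (mxA a zeta))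
          <= size (elementary_divisors (mxA a j)))%N)
    (r_gt0 : (0 < r)%N)
    (nu0_eigen : forall l : 'I_r, is_common_eigenvector a (nu l 0%N) (lam l))
    (s_ge2 : forall l : 'I_r, (2 <= s l)%N)
    (s_divisor : forall l : 'I_r,
       (lam l zeta, s l) \in elementary_divisors (mxA a zeta))
    (nu_generalized : forall (l : 'I_r) (theta : nat), (0 < theta < s l)%N ->
       is_generalized_eigenvector (mxA a zeta) (lam l zeta) (nu l) theta)
    (sum_s : (m + 1 <= \sum_(l < r) s l)%N)
    (X_domain : is_domain X)
    (nu0_neq0 : forall (l : 'I_r) (x : 'cV[R]_n), X x ->
       lform (nu l 0%N) x != 0)
    (v_solution : solves_v_system nu s v X)
    (no_integral : forall (j : 'I_m) (l : 'I_r) (theta : nat),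
       j != zeta -> (0 < theta < s l)%N ->
       ~ ode_first_integral a zeta X (frakp a j (v l theta))) :
  exists mu : 'I_r -> nat -> 'I_m -> R,
    [/\ forall (l : 'I_r) (theta : nat) (j : 'I_m) (x : 'cV[R]_n),
          (0 < theta < s l)%N -> X x -> frakp a j (v l theta) x = mu l theta j,
        exists (k : nat) (eps : 'I_r -> nat) (h : 'I_r -> nat -> R),
          admissible_orders m s k eps /\
          nontrivial_solution lam mu k eps (fun xi q => (h xi q)%:C)
      & forall (k : nat) (eps : 'I_r -> nat) (h : 'I_r -> nat -> R[i]),
          admissible_orders m s k eps ->
          nontrivial_solution lam mu k eps h ->
          autonomous_first_integral a X (integral_F nu v k eps h)].
Proof.
have [Xo _ [x0 Xx0]] := X_domain.
have nu1 l k : nu l 1%N <> k *: nu l 0%N.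
  move=> E; have [_] := nu_generalized l 1%N (s_ge2 l).
  have [nu00 eig] := nu0_eigen l.
  rewrite E -scalemxAr mulmxBl eig mul_scalar_mx subrr scaler0 scale1r => /esym.
  exact/eqP.
have phase l : exists cw : R[i] * (nat -> 'cV[R]_n), [/\ cw.1 != 0,
    forall theta, (theta < s l)%N -> nu l theta = cw.1 *: complexify (cw.2 theta)
    & forall x, X x -> 0 < rform (cw.2 0%N) x].
  have [c [w cwP]] := common_phase X_domain (s_ge2 l) (nu0_neq0 l) (nu1 l)
    (v_solution l).
  by exists (c, w).
have [cw cwP] := choice phase.
pose c l := (cw l).1; pose w l := (cw l).2.
have c_neq0 l : c l != 0 by case: (cwP l).
have nuE l theta : (theta < s l)%N -> nu l theta = c l *: complexify (w l theta).
  by case: (cwP l) => _ + _; apply.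
have w_gt0 l x : X x -> 0 < rform (w l 0%N) x by case: (cwP l) => _ _; apply.
have s_gt0 l : (0 < s l)%N by exact: ltnW.
pose lamR l j := complex.Re (lam l j).
have eig l j : lam l j = (lamR l j)%:C /\ realA a j *m w l 0%N = lamR l j *: w l 0%N.
  have [nu00 /(_ j)] := nu0_eigen l; rewrite nuE// => nuA.
  apply: real_eigenvalue nuA => //; apply: contraNneq nu00 => w0.
  by rewrite nuE// w0 /complexify map_mx0 scaler0.
have chain l k : (k < s l)%N ->
    realA a zeta *m w l k = lamR l zeta *: w l k + k%:R *: w l k.-1.
  case: k => [|k] ks; first by rewrite scale0r addr0; case: (eig l zeta).
  have [_] := nu_generalized l k.+1 ks; rewrite !nuE//; last exact: ltnW.
  by rewrite (eig l zeta).1; exact: real_chain.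
have system l t : (t.+1 < s l)%N -> forall x, X x -> rform (w l t.+1) x =
    \sum_(d < t.+1) 'C(t, d)%:R * v l d.+1 x * rform (w l (t - d)%N) x.
  move=> ts x Xx; have := v_solution l t.+1 ts x Xx.
  rewrite nuE// lformZ lform_complexify big_add1 /= big_mkord => E.
  apply: complexI; apply: (mulfI (c_neq0 l)); rewrite E rmorph_sum mulr_sumr.
  apply: eq_bigr => d _; rewrite subSS nuE; last first.
    by apply: leq_ltn_trans ts; apply: leq_trans (leq_subr _ _) _.
  by rewrite lformZ lform_complexify !rmorphM rmorph_nat mulrCA.
have smooth_v l t : (t.+1 < s l)%N -> smooth_on X (v l t.+1).
  exact: (smooth_quotient (w_gt0 l) (system l)).
have frakp_zeta l t x : (t.+1 < s l)%N -> X x ->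
    frakp a zeta (v l t.+1) x = (t == 0%N)%:R.
  exact: (frakp_quotient Xo (w_gt0 l) (system l) (chain l)).
have frakp_v l t j x : (t.+1 < s l)%N -> X x ->
    frakp a j (v l t.+1) x = frakp a j (v l t.+1) x0.
  move=> ts Xx; have [->|jz] := eqVneq j zeta; first by rewrite !frakp_zeta.
  (* The derivative along [zeta] vanishes by commutation, so only constants are left. *)
  apply: contrapT => neq; apply: (no_integral j l t.+1 jz ts).
  have sp := smooth_frakp a Xo j (smooth_v l t ts).
  split; [exact: smooth_C1| |by exists x, x0].
  move=> y Xy; rewrite (frakp_commute Xo zeta j a_solvable (smooth_v l t ts) Xy).
  rewrite (eq_on_frakp a Xo j Xy (fun z => frakp_zeta l t z ts)).
  exact: frakp_cst.
exists (fun l theta j => frakp a j (v l theta) x0); split.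
- by move=> l [//|t] j x ts Xx; exact: frakp_v.
- have [k [eps adm]] := exists_admissible_orders s_ge2 sum_s.
  have [h [hn hE]] := exists_nontrivial_solution lamR
    (fun l theta j => frakp a j (v l theta) x0) adm.
  exists k, eps, h; split=> //; split=> // j; rewrite -[RHS](hE j).
  by apply: eq_bigr => xi _; rewrite (eig xi j).1.
move=> k eps h [kr sum_eps eps_s] [_ hE].
have eps_lt (xi : 'I_r) q : (xi < k)%N -> (q < eps xi)%N -> (q.+1 < s xi)%N.
  by move=> xik qe; have := eps_s xi xik; have := s_ge2 xi; lia.
have sv (xi : 'I_r) q : (xi < k)%N -> (q < eps xi)%N -> smooth_on X (v xi q.+1).
  by move=> xik qe; apply: smooth_v; exact: eps_lt.
have pv (xi : 'I_r) q j x : (xi < k)%N -> (q < eps xi)%N -> X x ->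
    frakp a j (v xi q.+1) x = frakp a j (v xi q.+1) x0.
  by move=> xik qe; apply: frakp_v; exact: eps_lt.
pose L := log_combination (fun l => w l 0%N) v k eps.
(* The constant part of the logarithm of the integral comes from the phases. *)
pose K := \sum_(xi < r | (xi < k)%N) h xi 0%N * clog (c xi).
pose hRe xi q := complex.Re (h xi q); pose hIm xi q := complex.Im (h xi q).
have sL K0 g : smooth_on X (L K0 g) by exact: smooth_log_combination.
have pL K0 g j x : X x -> frakp a j (L K0 g) x = _ :=
  @frakp_log_combination _ _ _ _ a X Xo _ v lamR
    (fun l theta j => frakp a j (v l theta) x0) k eps w_gt0
    (fun l j => (eig l j).2) sv pv K0 g j x.
apply: (exp_first_integral Xo (sL (complex.Re K) hRe) (sL (complex.Im K) hIm)).
- move=> j x Xx; rewrite pL//.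
  have /(congr1 (@complex.Re R)) := hE j; rewrite Re_sum => hEj.
  rewrite -[RHS]hEj; apply: eq_bigr => xi _.
  rewrite Re_add Re_mul (eig xi j).1 /= mul0r subr0 Re_sum big_add1 /= big_mkord.
  by congr (_ + _); apply: eq_bigr => q _; rewrite Re_mul /= mul0r subr0.
- move=> j x Xx; rewrite pL//.
  have /(congr1 (@complex.Im R)) := hE j; rewrite Im_sum => hEj.
  rewrite -[RHS]hEj; apply: eq_bigr => xi _.
  rewrite Im_add Im_mul (eig xi j).1 /= mul0r addr0 Im_sum big_add1 /= big_mkord.
  by congr (_ + _); apply: eq_bigr => q _; rewrite Im_mul /= mul0r addr0.
move=> x Xx; rewrite /integral_F /cpow.
under eq_bigr => xi xik.
  rewrite -cexpD nuE// lformZ lform_complexify clog_ray ?w_gt0//.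
  over.
rewrite prod_cexp; congr cexp; rewrite [LHS]complex_parts; congr (_ +i* _).
- rewrite /L /log_combination Re_sum /K Re_sum -big_split; apply: eq_bigr => xi xik /=.
  rewrite Re_add mulrDr Re_add -addrA; congr (_ + (_ + _)).
    by rewrite Re_mul /= mulr0 subr0.
  rewrite Re_sum big_add1 /= big_mkord; apply: eq_bigr => q _.
  by rewrite Re_mul /= mulr0 subr0.
- rewrite /L /log_combination Im_sum /K Im_sum -big_split; apply: eq_bigr => xi xik /=.
  rewrite Im_add mulrDr Im_add -addrA; congr (_ + (_ + _)).
    by rewrite Im_mul /= mulr0 add0r.
  rewrite Im_sum big_add1 /= big_mkord; apply: eq_bigr => q _.
  by rewrite Im_mul /= mulr0 add0r.
Qed.
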